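(* Let $N\ge 3$ be an integer and let $\chi^{(N)}=\max_{\rho'\in\mathcal W^{(N)}}\mathcal R^{(2)}_{\rho'}$ be the maximum of the second moment of random correlations over the pure $N$-qubit $W$-class. Then every $\rho\in\mathrm{Conv}(\mathcal W^{(N)})$ satisfies $$\mathcal R^{(2)}_\rho\le\chi^{(N)}.$$ Moreover $\chi^{(3)}=\frac{11}{81}$, $\chi^{(4)}=\frac{4}{81}$ and $\chi^{(5)}=\frac{7}{405}$, and these values are attained by the three-, four- and five-qubit $W$-state, respectively.
   Context: For a unit vector $\boldsymbol u\in S^2\subset\mathbb R^3$ let $\sigma_{\boldsymbol u}=u_x\sigma_x+u_y\sigma_y+u_z\sigma_z$ with the Pauli matrices. For an $N$-qubit state (density matrix on $(\mathbb C^2)^{\otimes N}$) $\rho$ the second moment of random correlations is $$\mathcal R^{(2)}_\rho=\frac1{(4\pi)^N}\int_{S^2}d\boldsymbol u_1\cdots\int_{S^2}d\boldsymbol u_N\,\big(\mathrm{tr}[\rho\,(\sigma_{\boldsymbol u_1}\otimes\dots\otimes\sigma_{\boldsymbol u_N})]\big)^2,$$ with $d\boldsymbol u$ the surface measure on $S^2$ (total mass $4\pi$). The $N$-qubit $W$-state is $|W_N\rangle=\frac1{\sqrt N}\sum_{j}P_j\big(|1\rangle\otimes|0\rangle^{\otimes(N-1)}\big)$, the normalized sum of all $N$ computational basis states with exactly one qubit in $|1\rangle$. Two pure $N$-qubit states $|\Psi\rangle,|\Phi\rangle$ are SLOCC equivalent if there are invertible $2\times 2$ matrices $A_1,\dots,A_N$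 with $|\Psi\rangle=A_1\otimes\dots\otimes A_N|\Phi\rangle$. The pure $W$-class $\mathcal W^{(N)}$ is the set of (projectors onto) normalized pure states SLOCC equivalent to $|W_N\rangle$, and $\mathrm{Conv}(\mathcal W^{(N)})$ is the convex hull of the set of these projectors. *)

(* Defs.v *)
From HB Require Import structures.
From mathcomp Require Import all_boot all_order all_algebra.
From mathcomp Require Import all_classical all_reals all_analysis.
From mathcomp Require Import complex mxtens.

Set Implicit Arguments.
Unset Strict Implicit.
Unset Printing Implicit Defensive.

Import Order.TTheory GRing.Theory Num.Theory.
Import numFieldNormedType.Exports.

Local Open Scope classical_set_scope.
Local Open Scope ring_scope.
Local Open Scope complex_scope.
Local Open Scope sesquilinear_scope.

(* qdim N = 2 ^ N.  For a variable n, 2 ^ n.+1 is not convertible to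
   2 * 2 ^ n, so that the iterated Kronecker products below would need casts
   if they were typed with 2 ^ N. *)
Fixpoint qdim (N : nat) : nat := if N is n.+1 then (2 * qdim n)%N else 1%N.

Definition mx22 (R : rcfType) (a b c d : R[i]) : 'M[R[i]]_2 :=
  \matrix_(i < 2, j < 2) nth 0 (nth [::] [:: [:: a; b]; [:: c; d]] i) j.

Definition pauli_x (R : rcfType) : 'M[R[i]]_2 := mx22 0 1 1 0.
Definition pauli_y (R : rcfType) : 'M[R[i]]_2 := mx22 0 (- 'i) 'i 0.
Definition pauli_z (R : rcfType) : 'M[R[i]]_2 := mx22 1 0 0 (- 1).

Definition sigma (R : rcfType) (u : 'rV[R]_3) : 'M[R[i]]_2 :=
  (u 0 0)%:C *: pauli_x R + (u 0 1)%:C *: pauli_y R + (u 0 2)%:C *: pauli_z R.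

(* A_0 (x) ... (x) A_(N-1) *)
Fixpoint tens_op (R : rcfType) (N : nat) :
    ('I_N -> 'M[R[i]]_2) -> 'M[R[i]]_(qdim N) :=
  if N is n.+1 then fun A => A ord0 *t tens_op (fun i => A (lift ord0 i))
  else fun=> 1%:M.

Fixpoint tens_ket (R : rcfType) (N : nat) :
    ('I_N -> 'cV[R[i]]_2) -> 'cV[R[i]]_(qdim N) :=
  if N is n.+1 then fun v => v ord0 *t tens_ket (fun i => v (lift ord0 i))
  else fun=> 1%:M.

Definition qubit (R : rcfType) (b : 'I_2) : 'cV[R[i]]_2 := delta_mx b 0.

(* |psi><psi| *)
Definition projector (R : rcfType) (d : nat) (psi : 'cV[R[i]]_d) : 'M[R[i]]_d :=
  psi *m psi ^t*.

Definition normalized (R : rcfType) (d : nat) (psi : 'cV[R[i]]_d) : Prop :=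
  psi ^t* *m psi = 1%:M.

Definition W_state (R : rcfType) (N : nat) : 'cV[R[i]]_(qdim N) :=
  ((Num.sqrt N%:R)^-1)%:C *:
    \sum_(j < N) tens_ket (fun i => qubit R (if i == j then 1 else 0)).

Definition slocc_equiv (R : rcfType) (N : nat)
    (psi phi : 'cV[R[i]]_(qdim N)) : Prop :=
  exists A : 'I_N -> 'M[R[i]]_2,
    (forall i, A i \in unitmx) /\ psi = tens_op A *m phi.

Definition W_class (R : rcfType) (N : nat) : set 'M[R[i]]_(qdim N) :=
  [set rho | exists psi : 'cV[R[i]]_(qdim N),
     [/\ normalized psi, slocc_equiv psi (W_state R N) & rho = projector psi]].

(* Convex combinations with real weights of matrices with complex entries. *)
Definition convex_hull (R : rcfType) (d : nat) (S : set 'M[R[i]]_d) :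
    set 'M[R[i]]_d :=
  [set rho | exists (n : nat) (p : 'I_n -> R) (rho_ : 'I_n -> 'M[R[i]]_d),
     [/\ forall k, 0 <= p k, \sum_(k < n) p k = 1,
         forall k, S (rho_ k) & rho = \sum_(k < n) (p k)%:C *: rho_ k]].

(* theta is the polar angle and phi the azimuth. *)
Definition sphere_point (R : realType) (theta phi : R) : 'rV[R]_3 :=
  \row_(k < 3)
    [:: sin theta * cos phi; sin theta * sin phi; cos theta]`_k.

(* Integral over S^2 against the surface measure, whose element in the
   coordinates (theta, phi) is sin theta dtheta dphi; total mass 4 * pi. *)
Definition sphere_integral (R : realType) (f : 'rV[R]_3 -> R) : R :=
  \int[@lebesgue_measure R]_(theta in `[0, pi])
    \int[@lebesgue_measure R]_(phi in `[0, 2 * pi])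
      (f (sphere_point theta phi) * sin theta).

(* \int du_1 ... \int du_N F (u_1, ..., u_N), with u_1 outermost *)
Fixpoint spheres_integral (R : realType) (N : nat) :
    (N.-tuple 'rV[R]_3 -> R) -> R :=
  if N is n.+1 then fun F =>
    sphere_integral (fun u => spheres_integral (fun us => F [tuple of u :: us]))
  else fun F => F [tuple].

(* The trace is real for Hermitian rho, so that Re only changes its type. *)
Definition correlation (R : realType) (N : nat) (rho : 'M[R[i]]_(qdim N))
    (u : N.-tuple 'rV[R]_3) : R :=
  complex.Re (\tr (rho *m tens_op (fun i => sigma (tnth u i)))).

Definition second_moment (R : realType) (N : nat) (rho : 'M[R[i]]_(qdim N)) :
    R :=
  (4 * pi) ^- N * spheres_integral (fun u => correlation rho u ^+ 2).

Definition is_maximum (R : realType) (A : set R) (m : R) : Prop :=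
  A m /\ ubound A m.

(* Main.v *)
Require Import Defs.
From HB Require Import structures.
From mathcomp Require Import all_boot all_order all_algebra.
From mathcomp Require Import all_classical all_reals all_analysis.
From mathcomp Require Import complex mxtens ring.

Set Implicit Arguments.
Unset Strict Implicit.
Unset Printing Implicit Defensive.

Import Order.TTheory GRing.Theory Num.Theory.
Import numFieldNormedType.Exports.

Local Open Scope classical_set_scope.
Local Open Scope ring_scope.
Local Open Scope complex_scope.
Local Open Scope sesquilinear_scope.

(* Averaging over the sphere turns u_a u_b into delta_ab / 3, so the second
   moment is 3^-N times the squared norm of the tensor of full correlations
   tr (rho P), P a Pauli string without identity factor.  As a positive
   quadratic form in rho it is convex, which settles the mixed states.

   For pure states, Gram-Schmidt applied to A_i|0>, A_i|1> writes any state of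
   the W-class as a |e_1 ... e_N> + sum_j |e_1 ... f_j ... e_N> with e_i a unit
   vector orthogonal to f_i.  With p = |a|^2, t_j = |f_j|^2 and S = sum_j t_j,
   expanding one site at a time shows that the squared norm of its correlation
   tensor is (p + S)^2 + 4 (S^2 - sum_j t_j^2).  Normalization reads p + S = 1,
   so by Cauchy-Schwarz this is at most 5 - 4/N, with equality for the W-state
   (p = 0, t_j = 1/N): chi N = (5 - 4/N) / 3^N for every N. *)

(** * Integrals of quadratic forms over the sphere *)

Lemma Rintegral_is_derive (R : realType) (f F : R -> R) (a b : R) : a < b ->
  (forall x : R, derivable f x (1 : R)) ->
  (forall x : R, is_derive x (1 : R) F (f x)) ->
  \int[@lebesgue_measure R]_(x in `[a, b]) f x = F b - F a.
Proof.
move=> ab df dF.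
have cF x : {for x, continuous F}.
  apply: differentiable_continuous; apply/derivable1_diffP.
  exact: (@ex_derive _ _ _ _ _ _ _ (dF x)).
rewrite /Rintegral (@continuous_FTC2 _ _ F) //.
- apply: continuous_subspaceT => x; apply: differentiable_continuous.
  exact/derivable1_diffP.
- split.
  + by move=> x _; exact: (@ex_derive _ _ _ _ _ _ _ (dF x)).
  + by apply: cvg_at_right_filter; exact: cF.
  + by apply: cvg_at_left_filter; exact: cF.
- by move=> x _; rewrite derive1E (@derive_val _ _ _ _ _ _ _ (dF x)).
Qed.

(** At a fixed polar angle, a quadratic form in [u] times the surface element has this shape in the
    azimuth; over a full period only the squares and the constant survive. *)
Lemma Rintegral_azimuth (R : realType) (A B C D E F : R) :
  \int[@lebesgue_measure R]_(x in `[0, 2 * pi])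
    (A * (cos x * cos x) + B * (sin x * sin x) + C * (sin x * cos x)
     + D * cos x + E * sin x + F) = pi * (A + B + 2 * F).
Proof.
have dF (x : R) : is_derive x (1 : R)
    (fun x : R => A * (2^-1 * (x + sin x * cos x)) + B * (2^-1 * (x - sin x * cos x))
       + C * (2^-1 * (sin x * sin x)) + D * sin x + E * (- cos x) + F * x)
    (A * (cos x * cos x) + B * (sin x * sin x) + C * (sin x * cos x)
     + D * cos x + E * sin x + F).
  apply: is_derive_eq; rewrite /GRing.scale /= ?mulrN.
  have -> : sin x * sin x = 1 - cos x * cos x.
    by rewrite -(cos2Dsin2 x) -!expr2 addrC addKr.
  by field.
rewrite (Rintegral_is_derive _ _ dF); last 2 first.
- by rewrite mulr_gt0 ?pi_gt0.
- by move=> x; exact: ex_derive.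
rewrite sin0 cos0 mulr_natl sin2pi cos2pi; by field.
Qed.

Lemma Rintegral_polar (R : realType) (A B : R) :
  \int[@lebesgue_measure R]_(x in `[0, pi])
    (A * (sin x * sin x * sin x) + B * (cos x * cos x * sin x))
  = 4 / 3 * A + 2 / 3 * B.
Proof.
have dF (x : R) : is_derive x (1 : R)
    (fun x : R => A * (3^-1 * (cos x * cos x * cos x) - cos x)
                  + B * (- 3^-1 * (cos x * cos x * cos x)))
    (A * (sin x * sin x * sin x) + B * (cos x * cos x * sin x)).
  apply: is_derive_eq; rewrite /GRing.scale /= ?mulrN.
  have -> : sin x * sin x = 1 - cos x * cos x.
    by rewrite -(cos2Dsin2 x) -!expr2 addrC addKr.
  by field.
rewrite (Rintegral_is_derive _ _ dF); last 2 first.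
- exact: pi_gt0.
- by move=> x; exact: ex_derive.
rewrite cos0 cospi; by field.
Qed.
Lemma sphere_integral_quadratic (R : realType) (c : 'I_3 -> 'I_3 -> R) :
  sphere_integral (fun u => \sum_a \sum_b u 0 a * u 0 b * c a b)
  = 4 * pi / 3 * \sum_a c a a.
Proof.
pose i1 : 'I_3 := lift ord0 ord0; pose i2 : 'I_3 := lift ord0 (lift ord0 ord0).
pose g (theta : R) :=
  (pi * (c ord0 ord0 + c i1 i1)) * (sin theta * sin theta * sin theta)
  + (2 * pi * c i2 i2) * (cos theta * cos theta * sin theta).
transitivity (\int[@lebesgue_measure R]_(theta in `[0, pi]) g theta); last first.
  rewrite Rintegral_polar !big_ord_recl big_ord0 -/i1 -/i2; by field.
apply: eq_Rintegral => theta _.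
(* This is the value of the azimuth integral with [A], [B], [F] read off the diagonal of [c]; the
   off-diagonal entries enter only through [C], [D], [E], which integrate to zero. *)
have -> : g theta = pi * ((sin theta ^+ 3 * c ord0 ord0) +
   (sin theta ^+ 3 * c i1 i1) + 2 * (sin theta * cos theta ^+ 2 * c i2 i2)).
  by rewrite /g; ring.
rewrite -(Rintegral_azimuth _ _ (sin theta ^+ 3 * (c ord0 i1 + c i1 ord0))
  (sin theta ^+ 2 * cos theta * (c ord0 i2 + c i2 ord0))
  (sin theta ^+ 2 * cos theta * (c i1 i2 + c i2 i1))).
apply: eq_Rintegral => phi _.
by rewrite !big_ord_recl !big_ord0 !mxE /= -/i1 -/i2; ring.
Qed.

(** * Adjoints and traces of Kronecker products *)

Lemma adjmxM (R : rcfType) m n p (A : 'M[R[i]]_(m, n)) (B : 'M[R[i]]_(n, p)) :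
  (A *m B)^t* = B^t* *m A^t*.
Proof. by rewrite trmx_mul map_mxM. Qed.

Lemma adjmxK (R : rcfType) m n (A : 'M[R[i]]_(m, n)) : (A^t*)^t* = A.
Proof. by apply/matrixP => i j; rewrite !mxE conjCK. Qed.

Lemma adjmx_tens (R : rcfType) m n p q (A : 'M[R[i]]_(m, n)) (B : 'M[R[i]]_(p, q)) :
  (A *t B)^t* = (A^t*) *t (B^t*).
Proof. by rewrite trmx_tens map_mxT. Qed.

Lemma tensmx_sumZl (K : comPzRingType) (I : Type) (r : seq I) (c : I -> K) m n p q
    (A : I -> 'M[K]_(m, n)) (B : 'M[K]_(p, q)) :
  (\sum_(i <- r) c i *: A i) *t B = \sum_(i <- r) c i *: (A i *t B).
Proof.
apply/matrixP => i j; rewrite !mxE !summxE mulr_suml.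
by apply: eq_bigr => k _; rewrite !mxE mulrA.
Qed.

Lemma tensmxDl (K : pzRingType) m n p q (A A' : 'M[K]_(m, n)) (B : 'M[K]_(p, q)) :
  (A + A') *t B = A *t B + A' *t B.
Proof. by apply/matrixP => i j; rewrite !mxE mulrDl. Qed.

Lemma tensmxDr (K : pzRingType) m n p q (A : 'M[K]_(m, n)) (B B' : 'M[K]_(p, q)) :
  A *t (B + B') = A *t B + A *t B'.
Proof. by apply/matrixP => i j; rewrite !mxE mulrDr. Qed.

Lemma tensmxZl (K : pzRingType) m n p q k (A : 'M[K]_(m, n)) (B : 'M[K]_(p, q)) :
  (k *: A) *t B = k *: (A *t B).
Proof. by apply/matrixP => i j; rewrite !mxE mulrA. Qed.

Lemma tensmxZr (K : comPzRingType) m n p q k (A : 'M[K]_(m, n)) (B : 'M[K]_(p, q)) :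
  A *t (k *: B) = k *: (A *t B).
Proof. by apply/matrixP => i j; rewrite !mxE mulrCA. Qed.

Lemma tensmx_sumr (K : pzRingType) (I : Type) (r : seq I) m n p q
    (A : 'M[K]_(m, n)) (B : I -> 'M[K]_(p, q)) :
  A *t (\sum_(i <- r) B i) = \sum_(i <- r) A *t B i.
Proof.
by apply: (big_morph (fun B => A *t B)) => [B1 B2|]; rewrite ?tensmxDr ?tensmx0.
Qed.

Lemma mxtrace_tens (K : comPzRingType) m n (A : 'M[K]_m) (B : 'M[K]_n) :
  \tr (A *t B) = \tr A * \tr B.
Proof.
rewrite /mxtrace mulr_sum; apply: eq_bigr => i _.
by case: (mxtens_indexP i) => i0 i1; rewrite tensmxE mxtens_indexK.
Qed.

(** * Pauli strings and the second moment as a quadratic form *)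

Definition pauli (R : rcfType) (a : 'I_3) : 'M[R[i]]_2 :=
  [:: pauli_x R; pauli_y R; pauli_z R]`_a.

Lemma sigmaE (R : rcfType) (u : 'rV[R]_3) :
  sigma u = \sum_a (u 0 a)%:C *: pauli R a.
Proof.
rewrite !big_ord_recl big_ord0 addr0 addrA /sigma /pauli /=.
have -> : lift ord0 ord0 = 1 :> 'I_3 by apply/val_inj.
by have -> : lift ord0 (lift ord0 ord0) = 2 :> 'I_3 by apply/val_inj.
Qed.

Lemma pauli_herm (R : rcfType) a : (pauli R a)^t* = pauli R a.
Proof.
apply/matrixP => i j; rewrite /pauli.
case: a => [[|[|[|//]]] ?] /=; rewrite !mxE;
case: i => [[|[|//]] ?]; case: j => [[|[|//]] ?] /=;
  by apply/eqP; rewrite eq_complex /= ?oppr0 ?opprK !eqxx.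
Qed.

(* Each site contributes [sum_a tr (A sigma_a) tr (B sigma_a)]; since
   [sum_a sigma_a (x) sigma_a = 2 SWAP - 1], this is visibly invariant under
   local unitaries. *)
Lemma sum_pauli_trace (R : rcfType) (A B : 'M[R[i]]_2) :
  \sum_a \tr (A *m pauli R a) * \tr (B *m pauli R a)
  = 2 * \tr (A *m B) - \tr A * \tr B.
Proof.
have i2 : Num.imaginary * Num.imaginary = -1 :> R[i] by rewrite -expr2 sqrCi.
rewrite /mxtrace !(big_ord_recl, big_ord0, mxE) /=.
rewrite -[Complex 0 1]/(Num.imaginary : R[i]).
ring: i2.
Qed.

(* For L = L' = tr (rho *m _), the squared norm of the tensor of full
   correlations of rho. *)
Fixpoint pauli_form (R : rcfType) (K : comPzRingType) (n : nat) :
    ('M[R[i]]_(qdim n) -> K) -> ('M[R[i]]_(qdim n) -> K) -> K :=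
  if n is n.+1 then fun L L' =>
    \sum_(a < 3) pauli_form (fun M => L (pauli R a *t M))
                            (fun M => L' (pauli R a *t M))
  else fun L L' => L 1%:M * L' 1%:M.

Lemma pauli_formC (R : rcfType) (K : comPzRingType) n
    (L L' : 'M[R[i]]_(qdim n) -> K) : pauli_form L L' = pauli_form L' L.
Proof.
by elim: n L L' => [|n IH] L L' /=; [rewrite mulrC | apply: eq_bigr => a _].
Qed.

(** [K] is abstract because the form serves both over [R], for real parts of traces, and over
    [R[i]], for the traces themselves. *)
Lemma pauli_form_suml (R : rcfType) (K : comPzRingType) n (I : Type) (r : seq I)
    (c : I -> K) (L : I -> 'M[R[i]]_(qdim n) -> K) L' :
  pauli_form (fun M => \sum_(k <- r) c k * L k M) L'
  = \sum_(k <- r) c k * pauli_form (L k) L'.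
Proof.
elim: n L L' => [|n IH] L L' /=.
  by rewrite mulr_suml; apply: eq_bigr => k _; rewrite mulrA.
under eq_bigr do rewrite IH.
by rewrite exchange_big; apply: eq_bigr => k _; rewrite mulr_sumr.
Qed.

Lemma pauli_formZl (R : rcfType) (K : comPzRingType) n (c : K)
    (L L' : 'M[R[i]]_(qdim n) -> K) :
  pauli_form (fun M => c * L M) L' = c * pauli_form L L'.
Proof.
have := pauli_form_suml [:: tt] (fun=> c) (fun=> L) L'; rewrite big_seq1 => <-.
by congr pauli_form; apply/funext => M; rewrite big_seq1.
Qed.

(** Induction on the sites: once the first direction [u] is fixed, the integrand is again the square
    of a real linear functional, so the inner integrals give a quadratic form in [u], of which the
    outer one keeps the diagonal. *)
Lemma spheres_integral_sqr (R : realType) n (L : 'M[R[i]]_(qdim n) -> R) :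
  (forall a M M', L (a%:C *: M + M') = a * L M + L M') ->
  spheres_integral (fun u => L (tens_op (fun i => sigma (tnth u i))) ^+ 2)
  = (4 * pi / 3) ^+ n * pauli_form L L.
Proof.
elim: n L => [|n IH] L Llin; first by rewrite /= expr0 mul1r expr2.
have L0 : L 0 = 0.
  by apply: (addrI (L 0)); rewrite -{1}[L 0]mul1r -Llin scaler0 !addr0.
have Lsigma u M : L (sigma u *t M) = \sum_a u 0 a * L (pauli R a *t M).
  rewrite sigmaE tensmx_sumZl; elim: (index_enum _) => [|a r IHr].
    by rewrite !big_nil.
  by rewrite !big_cons Llin IHr.
rewrite /= exprS -mulrA.
rewrite [(_ ^+ n) * _]mulr_sumr.
rewrite -(sphere_integral_quadratic (fun a b => (4 * pi / 3) ^+ n *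
  pauli_form (fun M => L (pauli R a *t M)) (fun M => L (pauli R b *t M)))).
congr sphere_integral; apply/funext => u.
transitivity (spheres_integral (fun us : n.-tuple 'rV[R]_3 =>
   (\sum_a u 0 a * L (pauli R a *t tens_op (fun i => sigma (tnth us i)))) ^+ 2)).
  congr spheres_integral; apply/funext => us.
  rewrite -Lsigma; have -> // : (fun i => sigma (tnth [tuple of u :: us] (lift ord0 i)))
    = (fun i => sigma (tnth us i)).
  by apply/funext => i; rewrite tnthS.
rewrite (IH (fun M => \sum_a u 0 a * L (pauli R a *t M))); last first.
  move=> a M M'; rewrite mulr_sumr -big_split /=; apply: eq_bigr => b _.
  by rewrite tensmxDr tensmxZr Llin; ring.
(* Both slots are expanded, the second through symmetry, which yields the double sum over [a] and
   [b]. *)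
rewrite pauli_form_suml mulr_sumr; apply: eq_bigr => a _.
rewrite pauli_formC pauli_form_suml !mulr_sumr; apply: eq_bigr => b _.
by rewrite pauli_formC; ring.
Qed.

Lemma second_momentE (R : realType) n (rho : 'M[R[i]]_(qdim n)) :
  let L M := complex.Re (\tr (rho *m M)) in
  second_moment rho = 3 ^- n * pauli_form L L.
Proof.
move=> L; rewrite /second_moment /correlation (spheres_integral_sqr (L := L)).
  by rewrite expr_div_n !mulrA mulVf ?mul1r // expf_neq0 // mulf_neq0 ?gt_eqF ?pi_gt0.
move=> a M M'; rewrite /L mulmxDr -scalemxAr mxtraceD mxtraceZ.
case: (\tr (rho *m M)) => x y; case: (\tr (rho *m M')) => x' y' /=.
by rewrite mul0r subr0.
Qed.

(** Complex values allow non-Hermitian arguments, so that a projector can be split into rank-one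
    pieces [|x><y|]. *)
Definition moment_form (R : rcfType) n (A B : 'M[R[i]]_(qdim n)) : R[i] :=
  pauli_form (fun M => \tr (A *m M)) (fun M => \tr (B *m M)).

Lemma moment_formC (R : rcfType) n (A B : 'M[R[i]]_(qdim n)) :
  moment_form A B = moment_form B A.
Proof. exact: pauli_formC. Qed.

Lemma moment_formDl (R : rcfType) n (A A' B : 'M[R[i]]_(qdim n)) :
  moment_form (A + A') B = moment_form A B + moment_form A' B.
Proof.
(* A sum of two terms is a sum over a two-element list with weights 1, which [pauli_form_suml]
   covers. *)
pose L (b : bool) M := \tr ((if b then A else A') *m M).
rewrite /moment_form; transitivity (pauli_form
  (fun M => \sum_(b <- [:: true; false]) 1 * L b M) (fun M => \tr (B *m M))).
  congr pauli_form; apply/funext => M.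
  by rewrite !big_cons big_nil !mul1r addr0 /L mulmxDl mxtraceD.
by rewrite pauli_form_suml !big_cons big_nil !mul1r addr0.
Qed.

(** Traces of Kronecker products factor, so the first site splits off as the sum evaluated by
    [sum_pauli_trace]. *)
Lemma moment_form_tens (R : rcfType) n (a b : 'M[R[i]]_2) (A B : 'M[R[i]]_(qdim n)) :
  moment_form (n := n.+1) (a *t A) (b *t B)
  = (2 * \tr (a *m b) - \tr a * \tr b) * moment_form A B.
Proof.
rewrite -sum_pauli_trace mulr_suml.
transitivity (\sum_c pauli_form (fun M => \tr (a *t A *m (pauli R c *t M)))
                                (fun M => \tr (b *t B *m (pauli R c *t M)))) => //.
apply: eq_bigr => c _.
have E (x : 'M[R[i]]_2) (X : 'M[R[i]]_(qdim n)) :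
    (fun M => \tr (x *t X *m (pauli R c *t M)))
    = (fun M => \tr (x *m pauli R c) * \tr (X *m M)).
  by apply/funext => M; rewrite tensmx_mul mxtrace_tens.
by rewrite !E pauli_formZl pauli_formC pauli_formZl pauli_formC mulrA.
Qed.

(** A Hermitian matrix has real trace against every Pauli string, since Pauli strings are
    Hermitian. *)
Lemma moment_form_Re (R : rcfType) n (A : 'M[R[i]]_(qdim n)) : A^t* = A ->
  let L M := complex.Re (\tr (A *m M)) in
  moment_form A A = (pauli_form L L)%:C.
Proof.
move=> hA /=.
(* Generalized to functionals that are real on Hermitian matrices, a property that passes to
   [M |-> L (pauli R a *t M)] in the induction. *)
suff H (L : 'M[R[i]]_(qdim n) -> R[i]) :
    (forall M, M^t* = M -> L M = (complex.Re (L M))%:C) ->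
    pauli_form L L = (pauli_form (fun M => complex.Re (L M))
                                 (fun M => complex.Re (L M)))%:C.
  apply: H => M hM; apply/esym/RRe_real; apply/CrealP.
  by rewrite -trace_map_mx -mxtrace_tr map_trmx adjmxM hA hM mxtrace_mulC.
elim: {A hA} n L => [|n IH] L LR.
  rewrite rmorphM /= -!LR //.
  by apply/matrixP => i j; rewrite !mxE eq_sym conjC_nat.
rewrite /= rmorph_sum /=; apply: eq_bigr => a _; rewrite IH // => M hM.
by rewrite -LR // adjmx_tens pauli_herm hM.
Qed.

Lemma projector_herm (R : rcfType) d (psi : 'cV[R[i]]_d) :
  (projector psi)^t* = projector psi.
Proof. by rewrite adjmxM adjmxK. Qed.

Lemma second_moment_projector (R : realType) n (psi : 'cV[R[i]]_(qdim n)) :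
  (second_moment (projector psi))%:C
  = 3 ^- n * moment_form (projector psi) (projector psi).
Proof.
rewrite second_momentE moment_form_Re ?projector_herm // rmorphM fmorphV rmorphXn.
by rewrite rmorph_nat.
Qed.

(** * Convexity of the second moment *)

(** The variance of [x] under the weights [p] is nonnegative. *)
Lemma sqr_convex_sum (R : realFieldType) n (p x : 'I_n -> R) :
  (forall k, 0 <= p k) -> \sum_k p k = 1 ->
  (\sum_k p k * x k) ^+ 2 <= \sum_k p k * x k ^+ 2.
Proof.
move=> p0 p1; move em : (\sum_k p k * x k) => m.
have : 0 <= \sum_k p k * (x k - m) ^+ 2.
  by apply: sumr_ge0 => k _; rewrite mulr_ge0 ?sqr_ge0.
suff -> : \sum_k p k * (x k - m) ^+ 2 = \sum_k p k * x k ^+ 2 - m ^+ 2.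
  by rewrite subr_ge0.
transitivity (\sum_k p k * x k ^+ 2 - 2 * m * (\sum_k p k * x k) + m ^+ 2 * \sum_k p k).
  rewrite !mulr_sumr -sumrN -!big_split; apply: eq_bigr => k _ /=; ring.
by rewrite p1 em; ring.
Qed.

Lemma pauli_form_convex (R : realType) n m (p : 'I_m -> R)
    (L : 'I_m -> 'M[R[i]]_(qdim n) -> R) :
  (forall k, 0 <= p k) -> \sum_k p k = 1 ->
  pauli_form (fun M => \sum_k p k * L k M) (fun M => \sum_k p k * L k M)
  <= \sum_k p k * pauli_form (L k) (L k).
Proof.
move=> p0 p1; elim: n L => [|n IH] L /=; first exact: sqr_convex_sum.
apply: le_trans (ler_sum _ (fun a _ => IH _)) _.
by rewrite exchange_big; under eq_bigr do rewrite -mulr_sumr.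
Qed.

Lemma second_moment_convex (R : realType) n m (p : 'I_m -> R)
    (rho : 'I_m -> 'M[R[i]]_(qdim n)) :
  (forall k, 0 <= p k) -> \sum_k p k = 1 ->
  second_moment (\sum_k (p k)%:C *: rho k) <= \sum_k p k * second_moment (rho k).
Proof.
move=> p0 p1.
have -> : \sum_k p k * second_moment (rho k) = 3 ^- n * \sum_k p k *
    pauli_form (fun M => complex.Re (\tr (rho k *m M)))
               (fun M => complex.Re (\tr (rho k *m M))).
  by rewrite mulr_sumr; apply: eq_bigr => k _; rewrite second_momentE mulrCA.
rewrite second_momentE ler_wpM2l ?invr_ge0 ?exprn_ge0 //.
have -> : (fun M => complex.Re (\tr ((\sum_k (p k)%:C *: rho k) *m M)))
    = (fun M => \sum_k p k * complex.Re (\tr (rho k *m M))).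
  pose f (A : 'M[R[i]]_(qdim n)) := complex.Re (\tr A).
  have fD : {morph f : A B / A + B}.
    by move=> A B; rewrite /f mxtraceD; case: (\tr A); case: (\tr B).
  have f0 : f 0 = 0 by rewrite /f mxtrace0.
  apply/funext => M; rewrite -/(f _) mulmx_suml (big_morph f fD f0).
  apply: eq_bigr => k _; rewrite /f.
  by rewrite -scalemxAl mxtraceZ; case: (\tr _) => x y /=; rewrite mul0r subr0.
exact: pauli_form_convex.
Qed.

(** * Inner products and rank-one matrices *)

Definition dot (R : rcfType) d (x y : 'cV[R[i]]_d) : R[i] := (x^t* *m y) 0 0.

Definition outer (R : rcfType) d (x y : 'cV[R[i]]_d) : 'M[R[i]]_d := x *m y^t*.

Lemma dotDl (R : rcfType) d (x x' y : 'cV[R[i]]_d) :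
  dot (x + x') y = dot x y + dot x' y.
Proof. by rewrite /dot linearD map_mxD mulmxDl mxE. Qed.

Lemma dotDr (R : rcfType) d (x y y' : 'cV[R[i]]_d) :
  dot x (y + y') = dot x y + dot x y'.
Proof. by rewrite /dot mulmxDr mxE. Qed.

Lemma dotZl (R : rcfType) d k (x y : 'cV[R[i]]_d) :
  dot (k *: x) y = Num.conj k * dot x y.
Proof. by rewrite /dot linearZ map_mxZ -scalemxAl mxE. Qed.

Lemma dotZr (R : rcfType) d k (x y : 'cV[R[i]]_d) :
  dot x (k *: y) = k * dot x y.
Proof. by rewrite /dot -scalemxAr mxE. Qed.

Lemma dot_conj (R : rcfType) d (x y : 'cV[R[i]]_d) :
  Num.conj (dot x y) = dot y x.
Proof. by rewrite /dot -[x in RHS]adjmxK -adjmxM [RHS]mxE [in RHS]mxE. Qed.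

Lemma dot_tens (R : rcfType) m n (x x' : 'cV[R[i]]_m) (y y' : 'cV[R[i]]_n) :
  dot (x *t y) (x' *t y') = dot x x' * dot y y'.
Proof.
rewrite /dot (adjmx_tens x y) (tensmx_mul (x^t*) (y^t*) x' y') mxE.
by case: (mxtens_unindex _) => i j; rewrite (ord1 i) (ord1 j).
Qed.

Lemma mxtrace_outer (R : rcfType) d (x y : 'cV[R[i]]_d) :
  \tr (outer x y) = dot y x.
Proof. by rewrite mxtrace_mulC /mxtrace big_ord1. Qed.

Lemma mxtrace_outerM (R : rcfType) d (x y z w : 'cV[R[i]]_d) :
  \tr (outer x y *m outer z w) = dot y z * dot w x.
Proof.
rewrite /outer -mulmxA mxtrace_mulC /mxtrace big_ord1 !mulmxA -[_ *m z *m _ *m x]mulmxA.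
by rewrite mxE big_ord1.
Qed.

Lemma outer_tens (R : rcfType) m n (x x' : 'cV[R[i]]_m) (y y' : 'cV[R[i]]_n) :
  outer (x *t y) (x' *t y') = outer x x' *t outer y y'.
Proof. 
by rewrite /outer (adjmx_tens x' y') (tensmx_mul x y (x'^t*) (y'^t*)).
Qed.

(** The moment form on [|x><y|] and [|z><w|]; it is additive in each vector, so superpositions
    expand term by term. *)
Definition moment4 (R : rcfType) n (x y z w : 'cV[R[i]]_(qdim n)) : R[i] :=
  moment_form (outer x y) (outer z w).

Lemma moment4C (R : rcfType) n (x y z w : 'cV[R[i]]_(qdim n)) :
  moment4 x y z w = moment4 z w x y.
Proof. exact: moment_formC. Qed.

Lemma moment4D1 (R : rcfType) n (x x' y z w : 'cV[R[i]]_(qdim n)) :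
  moment4 (x + x') y z w = moment4 x y z w + moment4 x' y z w.
Proof. by rewrite /moment4 /outer mulmxDl moment_formDl. Qed.

Lemma moment4D2 (R : rcfType) n (x y y' z w : 'cV[R[i]]_(qdim n)) :
  moment4 x (y + y') z w = moment4 x y z w + moment4 x y' z w.
Proof. by rewrite /moment4 /outer linearD map_mxD mulmxDr moment_formDl. Qed.

Lemma moment4D3 (R : rcfType) n (x y z z' w : 'cV[R[i]]_(qdim n)) :
  moment4 x y (z + z') w = moment4 x y z w + moment4 x y z' w.
Proof. by rewrite !(moment4C x) moment4D1. Qed.

Lemma moment4D4 (R : rcfType) n (x y z w w' : 'cV[R[i]]_(qdim n)) :
  moment4 x y z (w + w') = moment4 x y z w + moment4 x y z w'.
Proof. by rewrite !(moment4C x) moment4D2. Qed.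

Lemma moment4_tens (R : rcfType) n (a b c d : 'cV[R[i]]_2)
    (x y z w : 'cV[R[i]]_(qdim n)) :
  moment4 (n := n.+1) (a *t x) (b *t y) (c *t z) (d *t w)
  = (2 * (dot b c * dot d a) - dot b a * dot d c) * moment4 x y z w.
Proof.
by rewrite /moment4 !outer_tens moment_form_tens mxtrace_outerM !mxtrace_outer.
Qed.

Lemma moment4_0 (R : rcfType) (x y z w : 'cV[R[i]]_(qdim 0)) :
  moment4 x y z w = dot y x * dot w z.
Proof. by rewrite /moment4 /moment_form /= !mulmx1 !mxtrace_outer. Qed.

(** * Correlations of W-like states *)

(** The vectors [f j] need not be unit vectors: they carry the amplitudes of the excited terms. *)
Definition W_like (R : rcfType) n (a : R[i]) (e f : 'I_n -> 'cV[R[i]]_2) :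
    'cV[R[i]]_(qdim n) :=
  a *: tens_ket e + \sum_j tens_ket (fun i => if i == j then f i else e i).

(** The excitation sits either on a later site or on the first one. *)
Lemma W_likeS (R : rcfType) n (a : R[i]) (e f : 'I_n.+1 -> 'cV[R[i]]_2) :
  let e' i := e (lift ord0 i) in
  W_like a e f = e ord0 *t W_like a e' (fun i => f (lift ord0 i))
                 + f ord0 *t tens_ket e'.
Proof.
move=> e'; rewrite /W_like big_ord_recl /= addrCA addrC tensmxDr tensmxZr.
by rewrite tensmx_sumr.
Qed.

(** Orthogonality is recorded in both orders so that each can be used for rewriting. *)
Definition orthogonal_frame (R : rcfType) n (e f : 'I_n -> 'cV[R[i]]_2)
    (t : 'I_n -> R[i]) :=
  forall i, [/\ dot (e i) (e i) = 1, dot (e i) (f i) = 0, dot (f i) (e i) = 0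
              & dot (f i) (f i) = t i].

(* Only these four values of [moment4] on [psi] and [o] (up to symmetry) enter
   the recursion for [moment4 psi psi psi psi]. *)
Lemma W_like_moments (R : rcfType) n (a : R[i]) (e f : 'I_n -> 'cV[R[i]]_2)
    (t : 'I_n -> R[i]) :
  orthogonal_frame e f t ->
  let o := tens_ket e in let psi := W_like a e f in
  let p := a * Num.conj a in let s := \sum_i t i in
  [/\ dot o o = 1, dot psi psi = p + s, moment4 o o o o = 1,
      moment4 psi psi o o = p - s &
      moment4 psi o o psi = p + 2 * s /\
      moment4 psi psi psi psi = (p + s) ^+ 2 + 4 * (s ^+ 2 - \sum_i t i ^+ 2)].
Proof.
elim: n e f t => [|n IH] e f t hef o psi p s.
  have oo : dot o o = 1 by rewrite /dot mulmx1 !mxE eqxx conjC_nat.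
  have -> : psi = a *: o by rewrite /psi /W_like big_ord0 addr0.
  rewrite /s !big_ord0 !moment4_0 !dotZl !dotZr oo.
  by split; last split; rewrite /p; ring.
have [oo pp Moo Mpo [Mop Mpp]] := IH _ _ _ (fun i => hef (lift ord0 i)).
have [ee ef fe ff] := hef ord0.
rewrite /psi W_likeS; set psi' := W_like _ _ _; set o' := tens_ket _.
have -> : o = e ord0 *t o' by [].
have Mop' : moment4 o' o' psi' psi' = p - \sum_(i < n) t (lift ord0 i).
  by rewrite moment4C Mpo.
have Mpo' : moment4 o' psi' psi' o' = p + 2 * \sum_(i < n) t (lift ord0 i).
  by rewrite moment4C Mop.
rewrite /s !big_ord_recl; split.
- by rewrite dot_tens ee oo mul1r.
- by rewrite dotDl !dotDr !dot_tens ee ef fe ff pp oo /p; ring.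
- by rewrite moment4_tens ee Moo; ring.
- rewrite moment4D1 !moment4D2 !moment4_tens ee ef fe ff Mpo Moo -/p; ring.
split.
  rewrite moment4D1 !moment4D4 !moment4_tens ee ef fe ff Mop Moo -/p; ring.
(* Of the sixteen terms, orthogonality at the first site leaves the six whose vectors there agree in
   pairs, first with second and third with fourth, or second with third and fourth with first. *)
rewrite moment4D1 !moment4D2 !moment4D3 !moment4D4 !moment4_tens.
rewrite ee ef fe ff Mpp Moo Mpo Mop Mop' Mpo' -/p.
rewrite !(mul0r, mulr0, subr0, sub0r, add0r, addr0, mulr1).
move: (\sum_i t _) (\sum_i t _ ^+ 2) (t ord0) => S Q u; ring.
Qed.

(** * Local normal form of the W-class *)

Lemma W_likeDa (R : rcfType) n (a c : R[i]) (e f : 'I_n -> 'cV[R[i]]_2) :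
  W_like (a + c) e f = c *: tens_ket e + W_like a e f.
Proof. by rewrite /W_like scalerDl addrA [c *: _ + _]addrC. Qed.

Lemma tens_ketZ (R : rcfType) n (r : 'I_n -> R[i]) (e : 'I_n -> 'cV[R[i]]_2) :
  tens_ket (fun i => r i *: e i) = (\prod_i r i) *: tens_ket e.
Proof.
elim: n r e => [|n IH] r e /=; first by rewrite big_ord0 scale1r.
by rewrite IH big_ord_recl tensmxZl tensmxZr scalerA.
Qed.

(** Each excited term contains exactly one [f i], which can absorb the scalar. *)
Lemma W_likeZ (R : rcfType) n (k a : R[i]) (e f : 'I_n -> 'cV[R[i]]_2) :
  k *: W_like a e f = W_like (k * a) e (fun i => k *: f i).
Proof.
elim: n e f => [|n IH] e f; first by rewrite /W_like !big_ord0 !addr0 scalerA.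
by rewrite !W_likeS -IH scalerDr tensmxZr tensmxZl.
Qed.

(** By multilinearity, the part of an excited vector along [e i] gives back the unexcited product,
    so [c i] joins the amplitude [a]; every term carries each [r i] once. *)
Lemma W_like_frame (R : rcfType) n (a : R[i]) (r c : 'I_n -> R[i])
    (e f : 'I_n -> 'cV[R[i]]_2) :
  W_like a (fun i => r i *: e i) (fun i => r i *: (c i *: e i + f i))
  = (\prod_i r i) *: W_like (a + \sum_i c i) e f.
Proof.
elim: n r c e f => [|n IH] r c e f.
  by rewrite /W_like !big_ord0 !addr0 scale1r.
rewrite !W_likeS IH tens_ketZ !big_ord_recl [c ord0 + _]addrC addrA.
rewrite (W_likeDa _ (c ord0)).
move: (W_like _ _ _) (tens_ket _) => X T.
rewrite !(tensmxZl, tensmxZr, tensmxDr, tensmxDl) !scalerDr !scalerA.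
by rewrite addrA [_ + _ *: (e ord0 *t T)]addrC.
Qed.

Lemma tens_op_ket (R : rcfType) n (A : 'I_n -> 'M[R[i]]_2)
    (v : 'I_n -> 'cV[R[i]]_2) :
  tens_op A *m tens_ket v = tens_ket (fun i => A i *m v i).
Proof.
elim: n A v => [|n IH] A v /=; first by rewrite mul1mx.
rewrite -IH; exact: (tensmx_mul (A ord0) (tens_op (fun i => A (lift ord0 i)))
  (v ord0) (tens_ket (fun i => v (lift ord0 i)))).
Qed.

Lemma W_stateE (R : rcfType) n :
  W_state R n = ((Num.sqrt n%:R)^-1)%:C *:
    W_like 0 (fun=> qubit R 0) (fun=> qubit R 1).
Proof.
rewrite /W_state /W_like scale0r add0r; congr (_ *: _); apply: eq_bigr => j _.
by congr tens_ket; apply/funext => i; case: ifP.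
Qed.

Lemma tens_op_W_state (R : rcfType) n (A : 'I_n -> 'M[R[i]]_2) :
  tens_op A *m W_state R n = ((Num.sqrt n%:R)^-1)%:C *:
    W_like 0 (fun i => A i *m qubit R 0) (fun i => A i *m qubit R 1).
Proof.
rewrite W_stateE -scalemxAr /W_like !scale0r !add0r; congr (_ *: _).
rewrite mulmx_sumr; apply: eq_bigr => j _; rewrite tens_op_ket.
by congr tens_ket; apply/funext => i; case: ifP.
Qed.

Lemma dot_ge0 (R : rcfType) d (x : 'cV[R[i]]_d) : 0 <= dot x x.
Proof.
by rewrite /dot mxE; apply: sumr_ge0 => i _; rewrite !mxE mulrC mul_conjC_ge0.
Qed.

Lemma dot_eq0 (R : rcfType) d (x : 'cV[R[i]]_d) : (dot x x == 0) = (x == 0).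
Proof.
rewrite /dot mxE psumr_eq0 => [|i _]; last by rewrite !mxE mulrC mul_conjC_ge0.
apply/allP/eqP => [x0|-> i _]; last by rewrite /= !mxE mulr0 eqxx.
apply/matrixP => i j; rewrite (ord1 j) !mxE; have := x0 i (mem_index_enum i).
by rewrite /= !mxE mulrC mul_conjC_eq0 => /eqP.
Qed.

(** The norm [r] of [x] is factored out of [y] too, as [W_like_frame] requires. *)
Lemma gram_schmidt (R : rcfType) d (x y : 'cV[R[i]]_d) : x != 0 ->
  exists r c (e f : 'cV[R[i]]_d), [/\ x = r *: e, y = r *: (c *: e + f),
    dot e e = 1, dot e f = 0 & dot f e = 0].
Proof.
move=> x0; have xx : dot x x != 0 by rewrite dot_eq0.
pose r := sqrtC (dot x x).
have r0 : r != 0 by rewrite sqrtC_eq0.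
have rJ : Num.conj r^-1 = r^-1.
  by apply/CrealP/ger0_real; rewrite invr_ge0 sqrtC_ge0 dot_ge0.
pose e := r^-1 *: x; pose c := dot e (r^-1 *: y).
have ee : dot e e = 1.
  by rewrite dotZl dotZr rJ mulrA -invfM -expr2 sqrtCK mulVf.
have ef : dot e (r^-1 *: y - c *: e) = 0.
  by rewrite -scaleNr dotDr -/c (dotZr _ e e) ee mulr1 subrr.
exists r, c, e, (r^-1 *: y - c *: e); split => //.
- by rewrite scalerA mulfV // scale1r.
- by rewrite addrC subrK scalerA mulfV // scale1r.
- by rewrite -dot_conj ef rmorph0.
Qed.

(** * The upper bound on the W-class *)

(** With [s] the sum of the [t i], Cauchy-Schwarz bounds the last bracket by
    [s ^+ 2 * (1 - n%:R^-1)], and [s <= 1]. *)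
Lemma W_moment_le (K : numFieldType) n (p : K) (t : 'I_n -> K) : (0 < n)%N ->
  0 <= p -> (forall i, 0 <= t i) -> p + \sum_i t i = 1 ->
  (p + \sum_i t i) ^+ 2 + 4 * ((\sum_i t i) ^+ 2 - \sum_i t i ^+ 2)
  <= 5 - 4 / n%:R.
Proof.
move=> n0 p0 t0 pt; rewrite pt; move es : (\sum_i t i) pt => s ps.
have s0 : 0 <= s by rewrite -es sumr_ge0.
have s1 : s <= 1 by rewrite -ps lerDr.
have n0R : (n%:R : K) > 0 by rewrite ltr0n.
have : 0 <= \sum_i (n%:R * t i - s) ^+ 2.
  (* The lemma is applied over [R[i]], where a square is nonnegative only once its base is known to
     be real. *)
  apply: sumr_ge0 => i _; rewrite real_exprn_even_ge0 // rpredB ?rpredM //;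
  exact: ger0_real.
have -> : \sum_i (n%:R * t i - s) ^+ 2 = n%:R * (n%:R * \sum_i t i ^+ 2 - s ^+ 2).
  transitivity (n%:R ^+ 2 * \sum_i t i ^+ 2 - 2 * n%:R * s * \sum_i t i
    + \sum_(i < n) s ^+ 2).
    rewrite !mulr_sumr -sumrN -!big_split; apply: eq_bigr => k _ /=; ring.
  by rewrite es sumr_const card_ord -mulr_natl; ring.
rewrite pmulr_rge0 // subr_ge0; move: (\sum_i _) => Q sQ.
have sq1 : s ^+ 2 <= 1 by rewrite expr_le1.
have sQ' : s ^+ 2 / n%:R <= Q by rewrite ler_pdivrMr // mulrC.
rewrite expr1n (_ : 5 - 4 / n%:R = 1 + 4 * (1 - n%:R^-1)); last by ring.
rewrite lerD2l ler_pM2l //; apply: le_trans (_ : s ^+ 2 - s ^+ 2 / n%:R <= _).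
  by rewrite lerD2l lerN2.
have -> : s ^+ 2 - s ^+ 2 / n%:R = s ^+ 2 * (1 - n%:R^-1) by ring.
by rewrite ler_piMl // subr_ge0 invf_le1 // ler1n.
Qed.

Lemma second_moment_W_like (R : realType) n (a : R[i]) (e f : 'I_n -> 'cV[R[i]]_2)
    (t : 'I_n -> R[i]) : orthogonal_frame e f t ->
  (second_moment (projector (W_like a e f)))%:C = 3 ^- n *
    ((a * Num.conj a + \sum_i t i) ^+ 2 + 4 * ((\sum_i t i) ^+ 2 - \sum_i t i ^+ 2)).
Proof.
by move=> /W_like_moments-/(_ a)[_ _ _ _ [_ <-]]; rewrite second_moment_projector.
Qed.

Lemma normalized_dot (R : rcfType) d (psi : 'cV[R[i]]_d) :
  normalized psi <-> dot psi psi = 1.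
Proof.
split=> [h|h]; first by rewrite /dot h mxE eqxx.
by apply/matrixP => i j; rewrite (ord1 i) (ord1 j) [RHS]mxE eqxx.
Qed.

Lemma slocc_W_state (R : rcfType) n (psi : 'cV[R[i]]_(qdim n)) :
  slocc_equiv psi (W_state R n) ->
  exists a e f, psi = W_like a e f /\ orthogonal_frame e f (fun i => dot (f i) (f i)).
Proof.
move=> [A [Aunit ->]]; rewrite tens_op_W_state.
(* Invertibility of [A i] makes this vector nonzero, so Gram-Schmidt can start from it. *)
have x0 i : A i *m qubit R 0 != 0.
  apply/negP => /eqP /(congr1 (mulmx (invmx (A i)))).
  rewrite mulKmx // mulmx0 => /matrixP /(_ 0 0)/eqP.
  by rewrite !mxE eqxx oner_eq0.
have /boolp.choice [r] := fun i => gram_schmidt (A i *m qubit R 1) (x0 i).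
move=> /boolp.choice [c] /boolp.choice [e] /boolp.choice [f] H.
have -> : (fun i => A i *m qubit R 0) = (fun i => r i *: e i).
  by apply/funext => i; case: (H i).
have -> : (fun i => A i *m qubit R 1) = (fun i => r i *: (c i *: e i + f i)).
  by apply/funext => i; case: (H i).
rewrite W_like_frame scalerA W_likeZ.
(* The factor [1 / sqrt n] and the product of the [r i] have been absorbed into the amplitude and
   the [f i]; scaling keeps orthogonality. *)
eexists _, e, _; split; first by [].
move=> i; have [_ _ ee ef fe] := H i; split=> //.
  by rewrite dotZr ef mulr0.
by rewrite dotZl fe mulr0.
Qed.

Definition W_moment (R : realType) (n : nat) : R := (5 - 4 / n%:R) / 3 ^+ n.

Lemma W_moment_complex (R : realType) n :
  (W_moment R n)%:C = 3 ^- n * (5 - 4 / n%:R).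
Proof.
by rewrite /W_moment rmorphM fmorphV rmorphXn rmorphB rmorphM fmorphV !rmorph_nat mulrC.
Qed.

Lemma W_class_second_moment_le (R : realType) n (rho : 'M[R[i]]_(qdim n)) :
  (0 < n)%N -> @W_class R n rho -> second_moment rho <= W_moment R n.
Proof.
move=> n0 [psi [/normalized_dot npsi /slocc_W_state[a [e [f [psiE fr]]]] ->]].
rewrite -lecR W_moment_complex psiE (second_moment_W_like a fr).
rewrite ler_pM2l ?invr_gt0 ?exprn_gt0 ?ltr0n //.
apply: W_moment_le => //; first exact: mul_conjC_ge0.
  by move=> i; exact: dot_ge0.
(* The squared norm of [psi] is [p + s], so normalization is the constraint of the bound. *)
by have [_ <- _ _ _] := W_like_moments a fr; rewrite -psiE.
Qed.

(** * The W-state attains the bound *)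

Lemma W_state_W_like (R : rcfType) n : (0 < n)%N -> exists e f,
  W_state R n = W_like 0 e f /\ orthogonal_frame e f (fun=> n%:R^-1).
Proof.
(* The normalization moves into the excited vectors, which become [|1>] divided by [sqrt n]. *)
move=> n0; rewrite W_stateE W_likeZ mulr0; do 2 eexists; split; first by [].
have dotq (b c : 'I_2) : dot (qubit R b) (qubit R c) = (b == c)%:R.
  rewrite /dot mxE (bigD1 c) //= big1 => [|i ic]; rewrite !mxE ?(negPf ic) ?mulr0 //.
  by rewrite !eqxx addr0 mulr1 andbT conjC_nat eq_sym.
move=> i; rewrite !(dotZl, dotZr) !dotq /= !mulr0; split => //.
rewrite mulr1 conj_Creal; last by rewrite complex_real.
by rewrite -rmorphM -invfM -expr2 sqr_sqrtr ?ler0n // fmorphV rmorph_nat.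
Qed.

Lemma W_class_W_state (R : rcfType) n : (0 < n)%N ->
  @W_class R n (projector (W_state R n)).
Proof.
move=> n0; exists (W_state R n); split => //.
  apply/normalized_dot; have [e [f [-> fr]]] := W_state_W_like R n0.
  have [_ -> _ _ _] := W_like_moments 0 fr.
  by rewrite mul0r add0r sumr_const card_ord -(mulr_natr n%:R^-1) mulVf //
    pnatr_eq0 -lt0n.
exists (fun=> 1%:M); split => [i|]; first exact: unitmx1.
rewrite tens_op_W_state W_stateE.
by congr (_ *: W_like _ _ _); apply/funext => i; rewrite mul1mx.
Qed.

Lemma second_moment_W_state (R : realType) n : (0 < n)%N ->
  second_moment (projector (W_state R n)) = W_moment R n.
Proof.
move=> n0; apply: complexI; have [e [f [-> fr]]] := W_state_W_like R n0.
rewrite (second_moment_W_like 0 fr) W_moment_complex !sumr_const card_ord.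
have nR : n%:R != 0 :> R[i] by rewrite pnatr_eq0 -lt0n.
by rewrite -(mulr_natr n%:R^-1) -(mulr_natr (n%:R^-1 ^+ 2)); congr (_ * _); field.
Qed.

Theorem mainTheorem3 (R : realType) :
  exists chi : nat -> R,
    [/\ forall N : nat, (3 <= N)%N ->
          is_maximum [set second_moment rho | rho in @W_class R N] (chi N),
        forall (N : nat) (rho : 'M[R[i]]_(qdim N)), (3 <= N)%N ->
          convex_hull (@W_class R N) rho -> second_moment rho <= chi N,
        [/\ chi 3%N = 11 / 81, chi 4%N = 4 / 81 & chi 5%N = 7 / 405] &
        forall N : nat, (3 <= N <= 5)%N ->
          @W_class R N (projector (W_state R N)) /\
          second_moment (projector (W_state R N)) = chi N].
Proof.
have pos N : (3 <= N)%N -> (0 < N)%N by exact: leq_trans.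
exists (W_moment R); split.
- move=> N /pos N0; split; last by move=> _ [rho /(W_class_second_moment_le N0) ? <-].
  exists (projector (W_state R N)); first exact: W_class_W_state.
  exact: second_moment_W_state.
- move=> N rho /pos N0 [m [p [rho_ [p0 p1 Wrho ->]]]].
  apply: le_trans (second_moment_convex _ p0 p1) _.
  (* The bound is written as its own average under [p], for a termwise comparison. *)
  rewrite -[leRHS]mul1r -p1 mulr_suml; apply: ler_sum => k _.
  by rewrite ler_wpM2l // W_class_second_moment_le.
- by split; rewrite /W_moment; field.
- move=> N /andP[/pos N0 _]; split; first exact: W_class_W_state.
  exact: second_moment_W_state.
Qed.
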